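(* Let $\mathbb{B}=\{0,1\}$ and let $c\colon \mathbb{N}^2\to\mathbb{B}$ be a colouring with $c(i,j)=c(j,i)$ for all $i,j$. For every pair of functionals $\eta_0,\eta_1\colon (\mathbb{N}\to\mathbb{N})\to\mathbb{N}$ (equivalently, every $\eta\colon \mathbb{B}\times\mathbb{N}^{\mathbb{N}}\to\mathbb{N}$, $(x,F)\mapsto \eta_x F$) there exist a function $F\colon\mathbb{N}\to\mathbb{N}$ and a colour $x\in\mathbb{B}$ such that \[ \forall k \leq \eta_x F\ \bigl(k \leq F k \ \wedge\ \forall i, j \leq k\ (F i < F j \to c(Fi, Fj)=x)\bigr). \]
   Context: A colouring of pairs of natural numbers with two colours is encoded as a symmetric map $c\colon\mathbb{N}^2\to\mathbb{B}$. *)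

(* Defs.v *)
From mathcomp Require Export all_boot.
Set Implicit Arguments.
Unset Strict Implicit.
Unset Printing Implicit Defensive.

(* Main.v *)
(** There is even a single infinite homogeneous set that works for every [eta].
    Either every infinite [A] contains some [a] such that infinitely many [b] in [A] have
    [c a b = true], or some infinite [A0] contains no such [a]. In the second case, every [a]
    in every infinite subset [A] of [A0] has infinitely many [b] in [A] with [c a b = false].
    In either case the passage from [A] to [{b in A | a < b, c a b = x}], for the relevant
    fixed colour [x], can be iterated forever, and the chosen points [a] enumerate a
    homogeneous set. *)

Require Import Defs.
From mathcomp Require Import all_boot.
From Stdlib Require Import Classical ClassicalEpsilon.

Set Implicit Arguments.
Unset Strict Implicit.
Unset Printing Implicit Defensive.

Definition infinite (A : pred nat) : Prop := forall n, exists2 m, n <= m & A m.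

Definition color_above (c : nat -> nat -> bool) x a (A : pred nat) : pred nat :=
  [pred b | [&& A b, a < b & c a b == x]].

Lemma color_above_infinite c a (A : pred nat) :
  infinite A -> ~ infinite (color_above c true a A) ->
  infinite (color_above c false a A).
Proof.
move=> Ainf /not_all_ex_not[n nP] m.
(* Past [n], no [b] in [A] above [a] has colour [true] with [a], so any element of [A] past [m], [n]
   and [a] will do. *)
have [b] := Ainf (maxn (maxn m n) a.+1).
rewrite !geq_max -andbA => /and3P[mb nb ab] Ab.
exists b => //; apply/and3P; split=> //.
case cab: (c a b) => //; case: nP.
by exists b => //; apply/and3P; rewrite cab.
Qed.

(** [Q] is the invariant that keeps the thinning going. The sets [S n] decrease, so for [i < j] the
    point of [S j] lies in [S i.+1], the set cut out by the point of [S i]. *)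
Lemma homogeneous_enumeration c x (Q : pred nat -> Prop) A0 :
  Q A0 -> (forall A, Q A -> exists2 a, A a & Q (color_above c x a A)) ->
  exists2 F : nat -> nat,
    {homo F : i j / i < j} & forall i j, i < j -> c (F i) (F j) = x.
Proof.
move=> QA0 Qstep.
pose good (A : pred nat) a := A a /\ Q (color_above c x a A).
pose point A := epsilon (inhabits 0) (good A).
have pointP A : Q A -> good A (point A).
  by move=> /Qstep[a Aa Qa]; apply: epsilon_spec; exists a.
pose S n := iter n (fun A => color_above c x (point A) A) A0.
have QS n : Q (S n) by elim: n => //= n /pointP[].
have S_sub m n b : S (m + n) b -> S n b.
  by elim: m => //= m IHm /and3P[/IHm].
have later i j : i < j -> color_above c x (point (S i)) (S i) (point (S j)).
  move=> ij; apply: (S_sub (j - i.+1) i.+1).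
  by rewrite subnK //; have [] := pointP _ (QS j).
by exists (fun n => point (S n)) => i j /later/and3P[_ ? /eqP].
Qed.

Lemma infinite_ramsey_pairs c :
  exists (F : nat -> nat) (x : bool),
    {homo F : i j / i < j} /\ forall i j, i < j -> c (F i) (F j) = x.
Proof.
have [allA | notallA] := classic
    (forall A, infinite A -> exists2 a, A a & infinite (color_above c true a A)).
- have natinf : infinite predT by move=> n; exists n.
  by have [F Flt Fc] := homogeneous_enumeration natinf allA; exists F, true.
have [A0 A0P] := not_all_ex_not _ _ notallA.
have {A0P}[A0inf A0P] := imply_to_and _ _ A0P.
(* Inclusion in [A0] transfers the case assumption to [A]: infinitely many [true] partners in [A]
   would also lie in [A0]. *)
pose Q (A : pred nat) := infinite A /\ subpred A A0.
have QA0 : Q A0 by split=> // b.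
have Qstep A : Q A -> exists2 a, A a & Q (color_above c false a A).
  move=> [Ainf AA0]; have [a _ Aa] := Ainf 0; exists a => //.
  split; last by move=> b /and3P[/AA0].
  apply: color_above_infinite => // ainf.
  apply: A0P; exists a; first exact: AA0.
  move=> n; have [b nb /and3P[Ab ab cab]] := ainf n.
  by exists b => //; apply/and3P; split=> //; apply: AA0.
by have [F Flt Fc] := homogeneous_enumeration QA0 Qstep; exists F, false.
Qed.

Theorem theorem4p12 (c : nat -> nat -> bool)
    (c_sym : forall i j : nat, c i j = c j i)
    (eta : bool -> (nat -> nat) -> nat) :
  exists (F : nat -> nat) (x : bool),
    forall k : nat, k <= eta x F ->
      k <= F k /\
      (forall i j : nat, i <= k -> j <= k ->
         F i < F j -> c (F i) (F j) = x).
Proof.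
have [F [x [Flt Fc]]] := infinite_ramsey_pairs c.
exists F, x => k _; split.
  by elim: k => // k IHk; apply: leq_ltn_trans IHk (Flt _ _ _).
by move=> i j _ _; rewrite (leqW_mono (leq_mono Flt)); apply: Fc.
Qed.
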